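(* Let $f$ be a symmetric nontrivial tradeoff function, and let $N\sim F_N$ be a canonical noise distribution (CND) for $f$. Then for every integer $t\geq 0$, $$P(|N|\leq t/2)=\begin{cases}1-2f^{\circ k}(c_f)&\text{if } t=2k+1,\\ 1-2f^{\circ k}(1/2)&\text{if } t=2k,\end{cases}$$ where $k$ is a non-negative integer.
   Context: For probability distributions $P,Q$ on a common measurable space, the tradeoff function $T(P,Q):[0,1]\to[0,1]$ is $T(P,Q)(\alpha)=\inf\{1-\mathbb{E}_Q(\phi)\mid \mathbb{E}_P(\phi)\leq 1-\alpha\}$, the infimum over measurable tests $\phi$ with values in $[0,1]$. For random variables $X,Y$, $T(X,Y)$ denotes the tradeoff function of their laws. A function $f:[0,1]\to[0,1]$ is a tradeoff function if $f=T(P,Q)$ for some $P,Q$; equivalently, $f$ is convex, continuous, non-decreasing, and $f(x)\leq x$ for all $x\in[0,1]$. It is nontrivial if $f(\alpha)<\alpha$ for some $\alpha\in(0,1)$, and symmetric if $f=T(P,Q)$ implies $f=T(Q,P)$. Inequalities between functions are pointwise. For a symmetric tradeoff function $f$, $c_f$ is the unique value with $f(1-c_f)=c_f$. $f^{\circ k}=f\circ\cdots\circ f$ ($k$ times), with $f^{\circ 0}$ the identity. Canonical noise distribution: let $f$ be a symmetric tradeoff function and $N$ a continuous real random variable (continuous cdf) with cdf $F$. Then $F$ (or $N$) is a canonical noise distribution (CND) for $f$ if (1) $T(N,N+m)\geq f$ for all $m\in[0,1]$; (2) $f(\alpha)=T(N,N+1)(\alpha)$ for all $\alpha\in(0,1)$;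 (3) $T(N,N+1)(\alpha)=F(F^{-1}(\alpha)-1)$ for all $\alpha\in(0,1)$, where $F^{-1}$ is the quantile function; (4) $F(x)=1-F(-x)$ for all $x\in\mathbb{R}$. *)

(* Defs.v *)
(* MathComp-Analysis, over an abstract [R : realType]. *)
From HB Require Import structures.
From mathcomp Require Export all_boot all_order all_algebra.
From mathcomp Require Export all_classical all_reals all_analysis.
From mathcomp Require Export measurable_realfun.
Export Order.TTheory GRing.Theory Num.Theory.
Export numFieldNormedType.Exports.

Set Implicit Arguments.
Unset Strict Implicit.
Unset Printing Implicit Defensive.

Local Open Scope classical_set_scope.
Local Open Scope ring_scope.

Definition test d (T : measurableType d) (R : realType) (phi : T -> R) : Prop :=
  measurable_fun [set: T] phi /\ (forall x, 0 <= phi x <= 1).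

(* The expectation of a test is finite, so [fine] loses nothing.  For
   [0 <= alpha <= 1] the set is nonempty ([phi = 0]) and bounded below by 0, so
   [inf] is the true infimum; the values outside [0, 1] are irrelevant. *)
Definition tradeoff d (T : measurableType d) (R : realType)
    (P Q : probability T R) (alpha : R) : R :=
  inf [set 1 - fine ('E_Q[phi])%E | phi in
        [set phi : T -> R | test phi /\ fine ('E_P[phi])%E <= 1 - alpha]].

(* Functions on [0, 1] are represented by functions [R -> R], of which only the
   restriction to [0, 1] is ever constrained. *)
Definition represents (R : realType) (f : R -> R)
    d (T : measurableType d) (P Q : probability T R) : Prop :=
  forall alpha : R, 0 <= alpha <= 1 -> f alpha = tradeoff P Q alpha.

Definition tradeoff_function (R : realType) (f : R -> R) : Prop :=
  exists d (T : measurableType d) (P Q : probability T R), represents f P Q.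

Definition symmetric_tradeoff (R : realType) (f : R -> R) : Prop :=
  forall d (T : measurableType d) (P Q : probability T R),
    represents f P Q -> represents f Q P.

Definition nontrivial_tradeoff (R : realType) (f : R -> R) : Prop :=
  exists alpha : R, 0 < alpha < 1 /\ f alpha < alpha.

(* For a symmetric tradeoff function [f], the set below is a singleton; the
   default value 0 of [xget] is used only for other functions. *)
Definition c_ (R : realType) (f : R -> R) : R :=
  xget 0 [set c : R | 0 <= c <= 1 /\ f (1 - c) = c].

Definition rcdf d (Omega : measurableType d) (R : realType)
    (Pr : probability Omega R) (N : {RV Pr >-> R}) (x : R) : R :=
  fine (cdf N x).

(* For [0 < alpha < 1] the set is nonempty and bounded below. *)
Definition quantile (R : realType) (F : R -> R) (alpha : R) : R :=
  inf [set x | alpha <= F x].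

Definition tradeoff_shift d (Omega : measurableType d) (R : realType)
    (Pr : probability Omega R) (N : {RV Pr >-> R}) (m : R) : R -> R :=
  tradeoff (distribution Pr N)
    (distribution Pr ((N : {mfun Omega >-> R}) + cst m)).

Record CND d (Omega : measurableType d) (R : realType)
    (Pr : probability Omega R) (N : {RV Pr >-> R}) (f : R -> R) : Prop := {
  CND_continuous : continuous (rcdf N);
  CND_private : forall m : R, 0 <= m <= 1 ->
    forall alpha : R, 0 <= alpha <= 1 -> f alpha <= tradeoff_shift N m alpha;
  CND_tight : forall alpha : R, 0 < alpha < 1 ->
    f alpha = tradeoff_shift N 1 alpha;
  CND_threshold : forall alpha : R, 0 < alpha < 1 ->
    tradeoff_shift N 1 alpha = rcdf N (quantile (rcdf N) alpha - 1);
  CND_symmetric : forall x, rcdf N x = 1 - rcdf N (- x) }.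

(* Main.v *)
(* Write F for the cdf of N.  The threshold test y > x has level F x and value
   F (x - 1), so f (F x) <= F (x - 1); condition (3) gives f a >= F (x - 1) for
   every a > F x, and right-continuity of f yields f (F x) = F (x - 1) whenever
   F x < 1.  Iterate this from F 0 = 1/2 and from F (-1/2) = c_f: by symmetry of
   F the latter is the fixed point of c |-> f (1 - c).  Finally
   P(|N| <= x) = 1 - 2 F (-x) since F is continuous and symmetric. *)
Require Import Defs.
From mathcomp Require Import lra.
Local Open Scope classical_set_scope.
Local Open Scope ring_scope.

(** * Elementary bounds on tradeoff functions *)

Section tradeoff_theory.
Set Implicit Arguments.
Unset Strict Implicit.
Context d (T : measurableType d) (R : realType).
Implicit Types (P Q : probability T R) (phi : T -> R).

Lemma test_Lfun1 P phi : test phi -> phi \in Lfun P 1%E.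
Proof.
move=> [mphi phi01]; apply/Lfun1_integrable.
apply: measurable_bounded_integrable => //.
  by rewrite (le_lt_trans (probability_le1 _ _))// ltry.
exists 1; split; first exact: num_real.
move=> M M1 x _; have /andP[p0 p1] := phi01 x.
by rewrite /= ger0_norm// (le_trans p1)// ltW.
Qed.

Lemma test_expectation_fin_num P phi : test phi -> ('E_P[phi])%E \is a fin_num.
Proof. by move=> tphi; apply: expectation_fin_num; exact: test_Lfun1. Qed.

Lemma test_expectation01 P phi : test phi -> 0 <= fine ('E_P[phi])%E <= 1.
Proof.
move=> tphi; have [mphi phi01] := tphi.
have phi0 x : 0 <= phi x by case/andP: (phi01 x).
rewrite fine_ge0 ?expectation_ge0//=.
rewrite -lee_fin fineK ?test_expectation_fin_num// -(expectation_cst P 1).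
apply: expectation_le => //; apply: aeW => x /=.
by case/andP: (phi01 x).
Qed.

Lemma test_cst (r : R) : 0 <= r <= 1 -> test (cst r : T -> R).
Proof. by move=> r01; split. Qed.

(** Together with nonemptiness for [alpha <= 1], this makes [inf] in [tradeoff] a true infimum
    rather than a default value. *)
Lemma tradeoff_lbound P Q (alpha : R) : has_lbound
  [set 1 - fine ('E_Q[phi])%E | phi in
    [set phi : T -> R | test phi /\ fine ('E_P[phi])%E <= 1 - alpha]].
Proof.
exists 0 => _ [phi [tphi _] <-].
by have := test_expectation01 Q tphi; lra.
Qed.

Lemma tradeoff_nonempty P Q (alpha : R) : alpha <= 1 ->
  [set 1 - fine ('E_Q[phi])%E | phi in
    [set phi : T -> R | test phi /\ fine ('E_P[phi])%E <= 1 - alpha]] !=set0.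
Proof.
move=> a1; eexists; exists (cst 0); last reflexivity.
split; first by apply: test_cst; rewrite lexx ler01.
by rewrite expectation_cst /=; lra.
Qed.

Lemma tradeoff_le_test P Q (alpha : R) phi : test phi ->
  fine ('E_P[phi])%E <= 1 - alpha -> tradeoff P Q alpha <= 1 - fine ('E_Q[phi])%E.
Proof.
by move=> tphi aphi; apply: ge_inf; [exact: tradeoff_lbound|exists phi].
Qed.

Lemma le_tradeoff P Q (alpha x : R) : alpha <= 1 ->
  (forall phi, test phi -> fine ('E_P[phi])%E <= 1 - alpha ->
    x <= 1 - fine ('E_Q[phi])%E) ->
  x <= tradeoff P Q alpha.
Proof.
move=> a1 H; apply: lb_le_inf; first exact: tradeoff_nonempty.
by move=> _ [phi [tphi aphi] <-]; exact: H.
Qed.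

Lemma tradeoff_ge0 P Q (alpha : R) : alpha <= 1 -> 0 <= tradeoff P Q alpha.
Proof.
move=> a1; apply: le_tradeoff => // phi tphi _.
by have := test_expectation01 Q tphi; lra.
Qed.

(** At level 0 the constant test 1 is admissible and attains the lower bound 0. *)
Lemma tradeoff0 P Q : tradeoff P Q 0 = 0.
Proof.
apply/eqP; rewrite eq_le tradeoff_ge0// andbT.
have := @tradeoff_le_test P Q 0 (cst 1).
rewrite !expectation_cst /= subrr subr0; apply => //.
by apply: test_cst; rewrite lexx ler01.
Qed.

Lemma tradeoff_nondecreasing P Q (a b : R) : a <= b -> b <= 1 ->
  tradeoff P Q a <= tradeoff P Q b.
Proof.
move=> ab b1; apply: le_tradeoff => // phi tphi bphi.
by apply: tradeoff_le_test => //; lra.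
Qed.

(* A quantitative form of right-continuity in alpha, obtained by scaling a test
   by 1 - l. *)
Lemma tradeoff_shrink P Q (alpha l : R) : alpha <= 1 -> 0 <= l <= 1 ->
  tradeoff P Q (alpha + l * (1 - alpha)) <= tradeoff P Q alpha + l.
Proof.
move=> a1 /andP[l0 l1]; rewrite -lerBlDr; apply: le_tradeoff => // phi tphi aphi.
have [mphi phi01] := tphi.
have EZ P' : fine ('E_P'[(1 - l) \o* phi])%E = (1 - l) * fine ('E_P'[phi])%E.
  by rewrite expectationZl ?test_Lfun1// fineM// test_expectation_fin_num.
have tZ : test ((1 - l) \o* phi).
  split; first exact: measurable_funM.
  by move=> x /=; have := phi01 x; nra.
have := @tradeoff_le_test P Q (alpha + l * (1 - alpha)) _ tZ.
rewrite !EZ => /(_ _)/le_trans H.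
have := test_expectation01 Q tphi => Q01.
by rewrite lerBlDr; apply: H; nra.
Qed.

End tradeoff_theory.

(** * The cdf, its quantiles and threshold tests *)

Section cdf_theory.
Set Implicit Arguments.
Unset Strict Implicit.
Context d (Omega : measurableType d) (R : realType).
Context (Pr : probability Omega R) (N : {RV Pr >-> R}).

Lemma rcdfE x : Pr [set w | N w <= x] = (rcdf N x)%:E.
Proof. by rewrite /rcdf fineK ?fin_num_measure. Qed.

Lemma measurable_le x : measurable [set w | N w <= x].
Proof.
rewrite (_ : [set w | _] = N @^-1` `]-oo, x]); first exact: measurable_funPTI.
by apply/seteqP; split=> w /=; rewrite in_itv.
Qed.

Lemma measurable_lt x : measurable [set w | N w < x].
Proof.
rewrite (_ : [set w | _] = N @^-1` `]-oo, x[); first exact: measurable_funPTI.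
by apply/seteqP; split=> w /=; rewrite in_itv.
Qed.

Lemma rcdf_nondecreasing x y : x <= y -> rcdf N x <= rcdf N y.
Proof.
by move=> xy; rewrite fine_le ?fin_num_measure// cdf_nondecreasing.
Qed.

Lemma rcdf_ge0 x : 0 <= rcdf N x.
Proof. by rewrite fine_ge0// cdf_ge0. Qed.

Lemma rcdf_le1 x : rcdf N x <= 1.
Proof. by rewrite -lee_fin fineK ?fin_num_measure// cdf_le1. Qed.

Lemma rcdf_ge_ex (a : R) : a < 1 -> exists x, a <= rcdf N x.
Proof.
move=> a1; have cF : rcdf N x @[x --> +oo] --> (1 : R).
  exact/fine_cvg/cvg_cdfy1.
have Fa := cvgr_ge _ cF _ a1.
near (pinfty_nbhs R) => x; exists x; near: x; exact: Fa.
Unshelve. all: end_near. Qed.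

(** By monotonicity, every point where the cdf reaches [a] lies to the right of [x]. The bound
    [a < 1] ensures that such a point exists, so that [inf] is not a default value. *)
Lemma le_quantile (x a : R) : rcdf N x < a -> a < 1 -> x <= quantile (rcdf N) a.
Proof.
move=> xa a1; apply: lb_le_inf; first exact: rcdf_ge_ex.
move=> y /= ay; rewrite leNgt; apply/negP => yx.
by have := rcdf_nondecreasing (ltW yx); lra.
Qed.

(** The indicator of []x, +oo[] has expectation [1 - rcdf N x] under [N] and [1 - rcdf N (x - m)]
    under [N + m]. *)
Lemma tradeoff_shift_le_rcdf m x :
  tradeoff_shift N m (rcdf N x) <= rcdf N (x - m).
Proof.
have mx : measurable (`]x, +oo[ : set R) by [].
have xE z : Pr [set w | x < N w + z] = (1 - rcdf N (x - z))%:E.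
  rewrite EFinB -rcdfE -probability_setC; last exact: measurable_le.
  congr (Pr _); apply/seteqP; split=> w /=; first by move=> ?; apply/negP; lra.
  by move/negP; lra.
have distE (X : {mfun Omega >-> R}) z : (forall w, X w = N w + z) ->
    fine ('E_(distribution Pr X)[\1_`]x, +oo[])%E = 1 - rcdf N (x - z).
  move=> XE; rewrite expectation_indic// -[RHS]/(fine _%:E) -xE.
  by congr (fine (Pr _)); apply/seteqP; split=> w /=; rewrite in_itv/= andbT XE.
have := @tradeoff_le_test _ _ _ (distribution Pr N)
  (distribution Pr ((N : {mfun Omega >-> R}) + cst m)) (rcdf N x) (\1_`]x, +oo[).
(* The shift [z = 0] gives the level under [N]; [z = m] gives the power under [N + m]. *)
rewrite (distE _ 0)//; last by move=> w; rewrite addr0.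
rewrite (distE _ m)// subr0 lexx subKr; apply => //.
split; first exact: measurable_indic.
by move=> y; rewrite indicE; case: (_ \in _); rewrite lexx ler01.
Qed.

Lemma probability_abs_le x : continuous (rcdf N) -> 0 <= x ->
  Pr [set w | `|N w| <= x] = (rcdf N x - rcdf N (- x))%:E.
Proof.
move=> cF x0.
(* There is no atom at [- x]: for [y < - x] the cdf at [y] is at most the probability of the strict
   event, and [y] tends to [- x] from the left. *)
have ltE : Pr [set w | N w < - x] = (rcdf N (- x))%:E.
  have fp : Pr [set w | N w < - x] \is a fin_num.
    by rewrite fin_num_measure//; exact: measurable_lt.
  apply/eqP; rewrite eq_le; apply/andP; split.
    rewrite -rcdfE le_measure ?inE; [by []|exact: measurable_lt|exact: measurable_le|].
    by move=> w /= /ltW.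
  rewrite -[X in (_ <= X)%E]fineK// lee_fin.
  have cL : rcdf N y @[y --> (- x)^'-] --> rcdf N (- x).
    exact/cvg_at_left_filter/cF.
  rewrite -(cvg_lim _ cL)//; apply: limr_le; first by apply/cvg_ex; exists (rcdf N (- x)).
  near=> y; rewrite -lee_fin (fineK fp) -rcdfE le_measure ?inE//.
  - exact: measurable_le.
  - exact: measurable_lt.
  - by move=> w /= /le_lt_trans; apply; near: y; exact: nbhs_left_lt.
have mA : measurable [set w | `|N w| <= x].
  rewrite (_ : [set w | _] = [set w | N w <= x] `\` [set w | N w < - x]).
    apply: measurableD; [exact: measurable_le|exact: measurable_lt].
  apply/seteqP; split=> w /=; rewrite ler_norml; first by move=> ?; split; lra.
  by move=> [? /negP]; lra.
rewrite EFinB -rcdfE -ltE.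
rewrite (_ : [set w | N w <= x] = [set w | `|N w| <= x] `|` [set w | N w < - x]).
  rewrite measureU//; [|exact: measurable_lt|].
  rewrite addeK// fin_num_measure//; exact: measurable_lt.
  by apply/seteqP; split=> // w /= []; rewrite ler_norml; lra.
apply/seteqP; split=> w /=; rewrite ler_norml; last by case; lra.
by move=> ?; case: (ltP (N w) (- x)); [right|left; lra].
Unshelve. all: end_near. Qed.

End cdf_theory.

(** * Orbits of [f] along the cdf of a CND *)

Section CND_theory.
Set Implicit Arguments.
Unset Strict Implicit.
Context (R : realType) (f : R -> R) (hf : tradeoff_function f).
Context d (Omega : measurableType d) (Pr : probability Omega R).
Context (N : {RV Pr >-> R}) (hN : CND N f).

Lemma CND_rcdf_sub1 x : rcdf N x < 1 -> f (rcdf N x) = rcdf N (x - 1).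
Proof.
have [d' [T [P [Q fPQ]]]] := hf.
move=> F1; have F0 := rcdf_ge0 N x.
have F01 : 0 <= rcdf N x <= 1 by lra.
apply/eqP; rewrite eq_le; apply/andP; split.
  apply: le_trans (tradeoff_shift_le_rcdf N 1 x).
  by apply: (CND_private hN) => //; rewrite ler01 lexx.
have [F_eq0|F_neq0] := eqVneq (rcdf N x) 0.
  rewrite F_eq0 fPQ ?lexx ?ler01// tradeoff0 -F_eq0.
  by apply: rcdf_nondecreasing; lra.
(* [quantile] only gives the left end of a flat piece of the cdf, so the bound
   is obtained at levels just above [rcdf N x] and carried over by continuity. *)
apply/ler_addgt0Pr => e e0.
(* The bound by [e] controls the final error; the bound by [1 / 2] keeps the level [a] strictly
   below 1. *)
pose l := Num.min e (1 / 2).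
have l0 : 0 < l by rewrite lt_min e0; lra.
have le : l <= e by rewrite ge_min lexx.
have l2 : l <= 1 / 2 by rewrite ge_min lexx orbT.
pose a := rcdf N x + l * (1 - rcdf N x).
have a01 : rcdf N x < a < 1 by rewrite /a; nra.
have : rcdf N (x - 1) <= f a.
  rewrite (CND_tight hN); last lra.
  rewrite (CND_threshold hN); last lra.
  apply: rcdf_nondecreasing; rewrite lerD2r.
  by apply: le_quantile; lra.
move=> /le_trans; apply.
rewrite !fPQ//; last lra.
have lin : 0 <= l <= 1 by lra.
have := tradeoff_shrink P Q (ltW F1) lin.
by rewrite -/a; lra.
Qed.

Lemma rcdf0 : rcdf N 0 = 1 / 2.
Proof. by have := CND_symmetric hN 0; rewrite oppr0; lra. Qed.

(** The map sending [c] to [f (1 - c)] is non-increasing, so it meets the identity at most once. *)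
Lemma fixpoint_unique c c' : 0 <= c <= 1 -> 0 <= c' <= 1 ->
  f (1 - c) = c -> f (1 - c') = c' -> c = c'.
Proof.
have [d' [T [P [Q fPQ]]]] := hf.
move=> c01 c'01; rewrite !fPQ; [|lra|lra] => cE c'E.
have [/ltW cc'|/ltW cc'|//] := ltgtP c c'.
  by have := @tradeoff_nondecreasing _ _ _ P Q (1 - c') (1 - c); lra.
by have := @tradeoff_nondecreasing _ _ _ P Q (1 - c) (1 - c'); lra.
Qed.

(** A unit step to the left from [1 / 2] lands on its mirror image, so the symmetry of the cdf turns
    the shift identity into the fixed-point equation. *)
Lemma rcdf_half : rcdf N (- (1 / 2)) = c_ f.
Proof.
have [d' [T [P [Q fPQ]]]] := hf.
have F0 := rcdf_ge0 N (- (1 / 2)); have F1 := rcdf_le1 N (- (1 / 2)).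
have Fs : rcdf N (1 / 2) = 1 - rcdf N (- (1 / 2)) := CND_symmetric hN _.
have half : 1 / 2 - 1 = - (1 / 2) :> R by lra.
have c01 : [set c : R | 0 <= c <= 1 /\ f (1 - c) = c] (rcdf N (- (1 / 2))).
  split; first lra.
  rewrite -Fs; have [Flt1|Fge1] := ltP (rcdf N (1 / 2)) 1.
    by rewrite CND_rcdf_sub1// half.
  (* Here the cdf already equals 1 at [1 / 2], outside the range of [CND_rcdf_sub1]. The threshold
     bound still gives [f 1 <= 0], and tradeoff functions are non-negative. *)
  have Fm0 : rcdf N (- (1 / 2)) = 0 by lra.
  apply/eqP; rewrite eq_le; apply/andP; split.
    rewrite -half; apply: le_trans (tradeoff_shift_le_rcdf N 1 _).
    by apply: (CND_private hN); rewrite ?lexx ?ler01// rcdf_ge0 rcdf_le1.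
  by rewrite Fm0 fPQ ?tradeoff_ge0 ?rcdf_le1 ?rcdf_ge0.
apply/esym; apply: xget_unique => // c [c'01 cE].
by case: c01 => *; exact: fixpoint_unique.
Qed.

(** Moving left keeps the cdf below 1, so the shift identity applies at each step. *)
Lemma iter_rcdf x k : rcdf N x < 1 -> iter k f (rcdf N x) = rcdf N (x - k%:R).
Proof.
move=> F1; elim: k => [|k IH]; first by rewrite subr0.
rewrite iterS IH CND_rcdf_sub1; first by rewrite -addrA -opprD natr1.
apply: le_lt_trans F1; apply: rcdf_nondecreasing.
by rewrite lerBlDr lerDl.
Qed.

Lemma CND_probability_abs_le x : 0 <= x ->
  Pr [set w | `|N w| <= x] = (1 - 2 * rcdf N (- x))%:E.
Proof.
move=> x0; rewrite probability_abs_le//; last exact: (CND_continuous hN).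
by congr (_%:E); rewrite (CND_symmetric hN x); lra.
Qed.

End CND_theory.

Theorem lemma10 (R : realType) (f : R -> R)
    (hf : tradeoff_function f) (hsym : symmetric_tradeoff f)
    (hnontriv : nontrivial_tradeoff f)
    (d : measure_display) (Omega : measurableType d)
    (Pr : probability Omega R) (N : {RV Pr >-> R}) (hN : CND N f)
    (t k : nat) :
  (t = (2 * k + 1)%N ->
     Pr [set w | `|N w| <= t%:R / 2] = (1 - 2 * iter k f (c_ f))%:E) /\
  (t = (2 * k)%N ->
     Pr [set w | `|N w| <= t%:R / 2] = (1 - 2 * iter k f (1 / 2))%:E).
Proof.
have h1 : rcdf N 0 < 1 by rewrite (rcdf0 hN); lra.
have h2 : rcdf N (- (1 / 2)) < 1.
  by apply: le_lt_trans h1; apply: rcdf_nondecreasing; lra.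
split=> ->; rewrite (CND_probability_abs_le hN) ?divr_ge0//; congr (1 - 2 * _)%:E.
  (* Odd [t]: [k] unit steps from [- (1 / 2)] end at [- (2 * k + 1) / 2]. *)
  rewrite -(rcdf_half hf hN) (iter_rcdf hf hN)//; congr (rcdf N _).
  by rewrite natrD natrM; lra.
(* Even [t]: [k] unit steps from 0 end at [- k], which is [- t / 2]. *)
rewrite -(rcdf0 hN) (iter_rcdf hf hN)//; congr (rcdf N _).
by rewrite natrM; lra.
Qed.
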